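(* Let $A=(a_1\ a_2\ a_3)$ be a $1\times 3$ matrix of pairwise distinct positive integers, and let $M$ be a minimal Markov basis for $A$. Then $M$ is distance reducing if and only if $M$ reduces the distance of the circuits of $A$.
   Context: For $z\in\mathbb Z^n$, $z^+,z^-\in\mathbb N^n$ denote the unique vectors with disjoint supports and $z=z^+-z^-$; $\|\cdot\|$ is the $1$-norm. The toric ideal of $A$ is $I_A=\langle x^{u^+}-x^{u^-}: u\in\ker(A)\rangle$, $\ker(A)\subseteq\mathbb Z^n$. A Markov basis is a set $B\subseteq\ker(A)$ such that $\{x^{u^+}-x^{u^-}:u\in B\}$ generates $I_A$; it is minimal if no proper subset is a Markov basis. For nonzero $z\in\ker(A)$ and $u\in\ker(A)$, $u$ reduces the distance of $z$ if there exist $(p,q)\in\{(z^+,z^-),(z^-,z^+)\}$ and $\varepsilon\in\{1,-1\}$ with $p+\varepsilon u\in\mathbb N^n$ and $\|p+\varepsilon u-q\|<\|z\|$. A set $B$ reduces the distance of $Z\subseteq\ker(A)$ if every nonzero $z\in Z$ has its distance reduced by some $u\in B$; $B$ is distance reducing if it reduces the distance of $\ker(A)$. A circuit of $A$ is a nonzero element of $\ker(A)$ whose support has exactly two elements. *)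

(* Defs.v *)
From HB Require Import structures.
From mathcomp Require Import all_boot all_order all_algebra.
From mathcomp Require Import mpoly.
Set Implicit Arguments. Unset Strict Implicit. Unset Printing Implicit Defensive.
Import Order.TTheory GRing.Theory Num.Theory.
Local Open Scope ring_scope.

Definition in_ker (d n : nat) (A : 'M[int]_(d, n)) (z : 'cV[int]_n) : Prop :=
  A *m z = 0.

Definition vpos (n : nat) (z : 'cV[int]_n) : 'cV[int]_n :=
  \col_i Num.max (z i 0) 0.
Definition vneg (n : nat) (z : 'cV[int]_n) : 'cV[int]_n :=
  \col_i Num.max (- z i 0) 0.

Definition is_nat_vec (n : nat) (v : 'cV[int]_n) : Prop :=
  forall i, 0 <= v i 0.

Definition norm1 (n : nat) (v : 'cV[int]_n) : int := \sum_i `|v i 0|.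

(* monomial x^v for v in N^n (negative entries are truncated, never used) *)
Definition monom (K : fieldType) (n : nat) (v : 'cV[int]_n) : {mpoly K[n]} :=
  'X_[ [multinom absz (v i ord0) | i < n] ].
Arguments monom K {_}.

Definition binom (K : fieldType) (n : nat) (u : 'cV[int]_n) : {mpoly K[n]} :=
  monom K (vpos u) - monom K (vneg u).
Arguments binom K {_}.

Definition in_ideal (K : fieldType) (n : nat) (S : {mpoly K[n]} -> Prop)
    (p : {mpoly K[n]}) : Prop :=
  exists s : seq ({mpoly K[n]} * {mpoly K[n]}),
    (forall c, c \in s -> S c.2) /\ p = \sum_(c <- s) c.1 * c.2.
Arguments in_ideal K {_}.

Definition binoms (K : fieldType) (n : nat) (B : 'cV[int]_n -> Prop)
    (p : {mpoly K[n]}) : Prop :=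
  exists2 u, B u & p = binom K u.
Arguments binoms K {_}.

Definition toric_ideal (K : fieldType) (d n : nat) (A : 'M[int]_(d, n))
    (p : {mpoly K[n]}) : Prop :=
  in_ideal K (binoms K (in_ker A)) p.
Arguments toric_ideal K {_} {_}.

Definition markov_basis (K : fieldType) (d n : nat) (A : 'M[int]_(d, n))
    (B : 'cV[int]_n -> Prop) : Prop :=
  (forall u, B u -> in_ker A u) /\
  (forall p, in_ideal K (binoms K B) p <-> toric_ideal K A p).
Arguments markov_basis K {_} {_}.

Definition minimal_markov_basis (K : fieldType) (d n : nat)
    (A : 'M[int]_(d, n)) (B : 'cV[int]_n -> Prop) : Prop :=
  markov_basis K A B /\
  forall B' : 'cV[int]_n -> Prop,
    (forall u, B' u -> B u) -> (exists2 u, B u & ~ B' u) ->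
    ~ markov_basis K A B'.
Arguments minimal_markov_basis K {_} {_}.

Definition reduces_distance_of (n : nat) (u z : 'cV[int]_n) : Prop :=
  exists (pq : 'cV[int]_n * 'cV[int]_n) (eps : int),
    (pq = (vpos z, vneg z) \/ pq = (vneg z, vpos z)) /\
    (eps = 1 \/ eps = -1) /\
    is_nat_vec (pq.1 + eps *: u) /\
    norm1 (pq.1 + eps *: u - pq.2) < norm1 z.

Definition reduces_distance_set (n : nat) (B Z : 'cV[int]_n -> Prop) : Prop :=
  forall z, Z z -> z != 0 -> exists2 u, B u & reduces_distance_of u z.

Definition distance_reducing (d n : nat) (A : 'M[int]_(d, n))
    (B : 'cV[int]_n -> Prop) : Prop :=
  reduces_distance_set B (in_ker A).

Definition circuit (d n : nat) (A : 'M[int]_(d, n)) (z : 'cV[int]_n) : Prop :=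
  in_ker A z /\ z != 0 /\ #|[set i | z i 0 != 0]| = 2%N.

(* Main.v *)
(** The monomials of two points of a fiber {m in N^n : A m = b} differ by an
    element of the toric ideal, which lies in the ideal of a set B of moves iff
    the two points are joined by a walk in N^n with steps in B and -B. So Markov
    bases are the sets connecting all fibers. If M is a minimal one and v is in
    M, then points reached from v^- and from v^+ without v have disjoint
    supports: two points of that fiber with a common variable are joined by a
    walk which, divided by the variable, has no room for the step v.

    Call a kernel vector pure at l if l is its only negative coordinate. For
    three weights, every nonzero kernel vector is pure at some l up to sign. If
    a_i is the smallest weight and y is pure at i, the first step of a walk in M
    from y^- to y^+ puts fewer units on the other coordinates than it takes from
    x_i, so it shortens every vector to which it applies.

    Let {j, k} be the other two indices. A move of M shortening the circuit on
    {j, k} is, up to sign and to exchanging j and k, a vector w = (s, -t, r) with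
    s, r >= 0 and s < t + r. Disjointness of supports forces t to be the least
    positive integer with t a_j in the semigroup generated by a_i and a_k, or
    else s = 0 and the same holds with j and k exchanged. With w of this kind,
    any kernel vector is shortened by w, by a move pure at i, or by a move pure
    at k. *)

Require Import Defs.
From HB Require Import structures.
From mathcomp Require Import all_boot all_order all_algebra.
From mathcomp Require Import boolp.
From mathcomp Require Import freeg mpoly.
From mathcomp Require Import zify.
Set Implicit Arguments.
Unset Strict Implicit.
Unset Printing Implicit Defensive.
Import Order.TTheory GRing.Theory Num.Theory.
Local Open Scope ring_scope.

Section NatVectors.
Variable n : nat.
Implicit Types v w z u m : 'cV[int]_n.

Lemma add_colE v w l : (v + w) l 0 = v l 0 + w l 0.
Proof. by rewrite mxE. Qed.

Lemma opp_colE v l : (- v) l 0 = - v l 0.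
Proof. by rewrite mxE. Qed.

Lemma vposE z l : vpos z l 0 = Num.max (z l 0) 0.
Proof. by rewrite mxE. Qed.

Lemma vnegE z l : vneg z l 0 = Num.max (- z l 0) 0.
Proof. by rewrite mxE. Qed.

Definition entryE := (add_colE, opp_colE, vposE, vnegE).

Lemma is_nat_vecD v w : is_nat_vec v -> is_nat_vec w -> is_nat_vec (v + w).
Proof. by move=> v0 w0 l; rewrite mxE addr_ge0. Qed.

Lemma vpos_nat z : is_nat_vec (vpos z).
Proof. by move=> l; rewrite entryE; lia. Qed.

Lemma vneg_nat z : is_nat_vec (vneg z).
Proof. by move=> l; rewrite entryE; lia. Qed.

Lemma vpos_sub_vneg z : vpos z - vneg z = z.
Proof. by apply/colP => l /=; rewrite !entryE; lia. Qed.

Lemma vposN z : vpos (- z) = vneg z.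
Proof. by apply/colP => l /=; rewrite !entryE. Qed.

Lemma vnegN z : vneg (- z) = vpos z.
Proof. by rewrite -vposN opprK. Qed.

Lemma sub_vneg_nat m u :
  is_nat_vec m -> is_nat_vec (m + u) -> is_nat_vec (m - vneg u).
Proof. by move=> m0 mu0 l; move: (m0 l) (mu0 l); rewrite !entryE; lia. Qed.

Lemma col_neq0 z l : z l 0 != 0 -> z != 0.
Proof. by apply: contraNneq => ->; rewrite mxE. Qed.

Lemma norm1N z : norm1 (- z) = norm1 z.
Proof. by apply: eq_bigr => l _; rewrite opp_colE normrN. Qed.

Definition mnm_of v : 'X_{1..n} := [multinom absz (v l 0%R) | l < n].

Definition col_of (x : 'X_{1..n}) : 'cV[int]_n := \col_l (x l)%:Z.

Lemma col_of_nat x : is_nat_vec (col_of x).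
Proof. by move=> l; rewrite mxE. Qed.

Lemma mnm_ofK v : is_nat_vec v -> col_of (mnm_of v) = v.
Proof. by move=> v0; apply/colP => l; rewrite mxE mnmE gez0_abs ?v0. Qed.

Lemma col_ofK x : mnm_of (col_of x) = x.
Proof. by apply/mnmP => l; rewrite mnmE mxE. Qed.

Lemma mnm_ofD v w : is_nat_vec v -> is_nat_vec w ->
  mnm_of (v + w) = (mnm_of v + mnm_of w)%MM.
Proof.
move=> v0 w0; apply/mnmP => l; rewrite mnmDE !mnmE add_colE.
by move: (v0 l) (w0 l); lia.
Qed.

End NatVectors.

Section Kernel.
Variables (d n : nat) (A : 'M[int]_(d, n)).
Implicit Types u v : 'cV[int]_n.

Lemma in_kerD u v : in_ker A u -> in_ker A v -> in_ker A (u + v).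
Proof. by rewrite /in_ker mulmxDr => -> ->; rewrite addr0. Qed.

Lemma in_kerN u : in_ker A u -> in_ker A (- u).
Proof. by rewrite /in_ker mulmxN => ->; rewrite oppr0. Qed.

Lemma in_kerB u v : in_ker A u -> in_ker A v -> in_ker A (u - v).
Proof. by move=> Au /in_kerN; apply: in_kerD. Qed.

Lemma in_ker_vpos_vneg u :
  in_ker A u -> A *m vpos u = A *m vneg u.
Proof. by move=> Au; apply/subr0_eq; rewrite -mulmxBr vpos_sub_vneg. Qed.

End Kernel.

#[local] Hint Resolve vpos_nat vneg_nat : core.

(** * Markov bases and connectedness of fibers *)

Section IdealMembership.
Variables (K : fieldType) (n : nat).
Implicit Types (S : {mpoly K[n]} -> Prop) (p q : {mpoly K[n]}).

Lemma in_ideal0 S : in_ideal K S 0.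
Proof. by exists [::]; rewrite big_nil. Qed.

Lemma in_idealD S p q :
  in_ideal K S p -> in_ideal K S q -> in_ideal K S (p + q).
Proof.
move=> [s [Ss ->]] [t [St ->]]; exists (s ++ t); rewrite big_cat; split=> // c.
by rewrite mem_cat => /orP[/Ss|/St].
Qed.

Lemma in_idealM S q p : in_ideal K S p -> in_ideal K S (q * p).
Proof.
move=> [s [Ss ->]]; exists [seq (q * c.1, c.2) | c <- s]; split.
  by move=> _ /mapP[c /Ss Sc ->].
by rewrite big_map mulr_sumr; apply: eq_bigr => c _; rewrite mulrA.
Qed.

Lemma in_idealN S p : in_ideal K S p -> in_ideal K S (- p).
Proof. by rewrite -mulN1r; exact: in_idealM. Qed.

Lemma in_ideal_gen S p : S p -> in_ideal K S p.
Proof.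
move=> Sp; exists [:: (1, p)]; rewrite big_seq1 mul1r; split=> // c.
by rewrite inE => /eqP->.
Qed.

Lemma in_ideal_trans S S' p :
  (forall q, S q -> in_ideal K S' q) -> in_ideal K S p -> in_ideal K S' p.
Proof.
move=> SS' [s [Ss ->]]; rewrite big_seq.
apply: (big_ind (in_ideal K S')) => [||c /Ss Sc].
- exact: in_ideal0.
- exact: in_idealD.
- exact/in_idealM/SS'.
Qed.

End IdealMembership.

Section CoefficientSum.
Variables (K : fieldType) (n : nat) (T : pred 'X_{1..n}).
Implicit Types p : {mpoly K[n]}.

Definition coeff_sum p : K := fglift (fun x => (T x)%:R : K^o) (mpoly_val p).

Lemma coeff_sum_is_zmod_morphism : zmod_morphism coeff_sum.
Proof. by move=> p q; apply: (@lift_is_additive K _ K^o). Qed.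

HB.instance Definition _ :=
  GRing.isZmodMorphism.Build {mpoly K[n]} K coeff_sum coeff_sum_is_zmod_morphism.

Lemma coeff_sumZX c x : coeff_sum (c *: 'X_[x]) = c * (T x)%:R.
Proof.
have -> : c *: 'X_[x] = [mpoly << c *g x >>] :> {mpoly K[n]}.
  by apply/mpolyP => y; rewrite mcoeffZ mcoeffX mcoeff_MPoly coeffU.
by rewrite /coeff_sum liftU.
Qed.

End CoefficientSum.

Definition upto_sign n (B : 'cV[int]_n -> Prop) (u : 'cV[int]_n) : Prop :=
  B u \/ B (- u).

Lemma upto_signN n (B : 'cV[int]_n -> Prop) u :
  upto_sign B u -> upto_sign B (- u).
Proof. by rewrite /upto_sign opprK => -[]; [right|left]. Qed.

(* Every point of the walk but the starting one is required to lie in N^n. *)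
Inductive connected n (B : 'cV[int]_n -> Prop) (m : 'cV[int]_n) :
    'cV[int]_n -> Prop :=
| connected_refl : connected B m m
| connected_step u m' : upto_sign B u -> is_nat_vec (m + u) ->
    connected B (m + u) m' -> connected B m m'.

Section Connectedness.
Variable n : nat.
Implicit Types (B : 'cV[int]_n -> Prop) (m u w : 'cV[int]_n).

Lemma connected_nat B m m' : is_nat_vec m -> connected B m m' -> is_nat_vec m'.
Proof. by move=> + c; elim: c => {m m'} // m u m' _ mu0 _ IH _; apply: IH. Qed.

Lemma connected_move B m u :
  upto_sign B u -> is_nat_vec (m + u) -> connected B m (m + u).
Proof. by move=> Bu mu0; apply: connected_step Bu mu0 (connected_refl _ _). Qed.

Lemma connected_vneg_vpos B u w : B u -> is_nat_vec w ->
  connected B (w + vneg u) (w + vpos u).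
Proof.
move=> Bu w0; have def_wp : w + vneg u + u = w + vpos u.
  by rewrite -{2}[u]vpos_sub_vneg -addrA [vneg u + _]addrC subrK.
rewrite -def_wp; apply: connected_move; first by left.
by rewrite def_wp; apply: is_nat_vecD.
Qed.

Lemma connected_trans B m1 m2 m3 :
  connected B m1 m2 -> connected B m2 m3 -> connected B m1 m3.
Proof.
move=> c; elim: c => {m1 m2} // m u m' Bu mu0 _ IH /IH.
exact: connected_step.
Qed.

Lemma connected_sym B m m' :
  is_nat_vec m -> connected B m m' -> connected B m' m.
Proof.
move=> + c; elim: c => {m m'} [m|m u m' Bu mu0 _ IH] m0.
  exact: connected_refl.
apply: connected_trans (IH mu0) _; rewrite -{2}[m](addrK u).
by apply: connected_move; [exact: upto_signN | rewrite addrK].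
Qed.

Lemma connected_translate B w m m' : is_nat_vec w ->
  connected B m m' -> connected B (m + w) (m' + w).
Proof.
move=> w0 c; elim: c => {m m'} [m|m u m' Bu mu0 _ IH].
  exact: connected_refl.
apply: connected_step Bu _ _; rewrite addrAC //.
exact: is_nat_vecD.
Qed.

Lemma connected_of_moves B B' m m' : is_nat_vec m ->
  (forall u, B u -> connected B' (vneg u) (vpos u)) ->
  connected B m m' -> connected B' m m'.
Proof.
move=> + BB' c; elim: c => {m m'} [m|m u m' Bu mu0 _ IH] m0.
  exact: connected_refl.
apply: connected_trans (IH mu0).
have cu : connected B' (vneg u) (vpos u).
  case: Bu => /BB' //; rewrite vposN vnegN; exact: connected_sym.
have := connected_translate (sub_vneg_nat m0 mu0) cu.
rewrite addrC subrK; congr connected.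
by rewrite -{3}[u]vpos_sub_vneg addrCA.
Qed.

Lemma connected_neq_move B m m' : connected B m m' -> m != m' ->
  exists2 u, upto_sign B u & u != 0 /\ is_nat_vec (m + u).
Proof.
elim=> {m m'} [m|m u m' Bu mu0 _ IH nmm']; first by rewrite eqxx.
have [u0|nu0] := eqVneq u 0; last by exists u.
by have := IH; rewrite u0 addr0; apply.
Qed.

Lemma upto_sign_ker d (A : 'M[int]_(d, n)) B u :
  (forall v, B v -> in_ker A v) -> upto_sign B u -> in_ker A u.
Proof. by move=> BA [/BA//|/BA/in_kerN]; rewrite opprK. Qed.

Lemma connected_fiber d (A : 'M[int]_(d, n)) B m m' :
  (forall v, B v -> in_ker A v) -> connected B m m' -> A *m m' = A *m m.
Proof.
move=> BA; elim=> {m m'} // m u m' /(upto_sign_ker BA) Au _ _ ->.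
by rewrite mulmxDr Au addr0.
Qed.

End Connectedness.

Section FundamentalTheorem.
Variables (K : fieldType) (n : nat).
Implicit Types (B : 'cV[int]_n -> Prop) (m u w : 'cV[int]_n).

Lemma monomE v : monom K v = 'X_[mnm_of v] :> {mpoly K[n]}.
Proof. by []. Qed.

Lemma monomD v w : is_nat_vec v -> is_nat_vec w ->
  monom K (v + w) = monom K v * monom K w.
Proof. by move=> v0 w0; rewrite !monomE mnm_ofD // mpolyXD. Qed.

Lemma binomN u : binom K (- u) = - binom K u.
Proof. by rewrite /binom vposN vnegN opprB. Qed.

Lemma monom_sub_binom m u : is_nat_vec m -> is_nat_vec (m + u) ->
  monom K (m + u) - monom K m = monom K (m - vneg u) * binom K u.
Proof.
move=> m0 mu0; rewrite mulrBr -!monomD ?subrK //; try exact: sub_vneg_nat.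
by rewrite addrAC -addrA vpos_sub_vneg.
Qed.

Lemma connected_in_ideal B m m' : is_nat_vec m -> connected B m m' ->
  in_ideal K (binoms K B) (monom K m - monom K m').
Proof.
move=> + c; elim: c => {m m'} [m|m u m' Bu mu0 _ IH] m0.
  by rewrite subrr; apply: in_ideal0.
rewrite -(subrKA (monom K (m + u))); apply: in_idealD (IH mu0).
rewrite -opprB monom_sub_binom // -mulrN -binomN; apply: in_idealM.
case: Bu => Bu; last by apply: in_ideal_gen; exists (- u).
by rewrite binomN; apply: in_idealN; apply: in_ideal_gen; exists u.
Qed.

Lemma coeff_sum_in_ideal B (T : pred 'X_{1..n}) p :
  (forall u w, B u -> is_nat_vec w ->
    T (mnm_of (w + vpos u)) = T (mnm_of (w + vneg u))) ->
  in_ideal K (binoms K B) p -> coeff_sum T p = 0.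
Proof.
move=> TB [s [sB ->]]; rewrite big_seq raddf_sum big1 // => c /sB [u Bu ->].
rewrite [c.1]mpolyE mulr_suml raddf_sum big1 // => x _.
rewrite /binom -[x]col_ofK -scalerAl -monomE mulrBr.
have x0 := col_of_nat x; rewrite -!monomD // scalerBr raddfB /=.
by rewrite !monomE !coeff_sumZX TB // subrr.
Qed.

(* The sum of the coefficients over the monomials connected to [x^m] is a linear
   form that vanishes on the ideal. *)
Lemma in_ideal_connected B m m' : is_nat_vec m -> is_nat_vec m' ->
  in_ideal K (binoms K B) (monom K m - monom K m') -> connected B m m'.
Proof.
move=> m0 m'0; pose T x := `[< connected B m (col_of x) >].
have T_move u w : B u -> is_nat_vec w ->
    T (mnm_of (w + vpos u)) = T (mnm_of (w + vneg u)).
  move=> Bu w0; have cu := connected_vneg_vpos Bu w0.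
  have [wp0 wn0] : is_nat_vec (w + vpos u) /\ is_nat_vec (w + vneg u).
    by split; apply: is_nat_vecD.
  rewrite /T !mnm_ofK //; apply/asbool_equiv_eq.
  by split=> /connected_trans; apply=> //; apply: connected_sym.
move/(coeff_sum_in_ideal T_move).
rewrite raddfB /= !monomE -['X_[mnm_of m]]scale1r -['X_[mnm_of m']]scale1r.
rewrite !coeff_sumZX /T !mnm_ofK // !mul1r asboolT; last exact: connected_refl.
by case: asboolP => // _ /eqP; rewrite subr0 oner_eq0.
Qed.

Lemma monom_sub_toric d (A : 'M[int]_(d, n)) m m' :
  is_nat_vec m -> is_nat_vec m' -> A *m m = A *m m' ->
  toric_ideal K A (monom K m - monom K m').
Proof.
move=> m0 m'0 Amm'; have def_m : m = m' + (m - m') by rewrite addrC subrK.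
rewrite {1}def_m monom_sub_binom -?def_m //; apply: in_idealM.
apply: in_ideal_gen; exists (m - m') => //.
by rewrite /in_ker mulmxBr Amm' subrr.
Qed.

(* The theorem of Diaconis and Sturmfels: Markov bases are the sets of moves that
   connect every fiber of [A]. *)
Theorem markov_basisP d (A : 'M[int]_(d, n)) B :
  markov_basis K A B <->
  (forall u, B u -> in_ker A u) /\
  (forall m m', is_nat_vec m -> is_nat_vec m' -> A *m m = A *m m' ->
    connected B m m').
Proof.
split=> -[BA BI]; split=> //.
  move=> m m' m0 m'0 Amm'; apply: in_ideal_connected => //.
  by apply/BI; apply: monom_sub_toric.
move=> p; split; apply: in_ideal_trans => q [u Bu ->].
  by apply: in_ideal_gen; exists u => //; apply: BA.
by apply: connected_in_ideal => //; apply: BI => //; apply: in_ker_vpos_vneg.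
Qed.

End FundamentalTheorem.

(** * Minimal Markov bases *)

Definition without n (B : 'cV[int]_n -> Prop) (v u : 'cV[int]_n) : Prop :=
  [/\ B u, u <> v & u <> - v].

Lemma withoutN n (B : 'cV[int]_n -> Prop) v : without B (- v) = without B v.
Proof.
by apply/funext => u; apply/propext; rewrite /without opprK; split=> -[].
Qed.

Lemma upto_sign_without n (B : 'cV[int]_n -> Prop) v u :
  upto_sign B u -> u != v -> u != - v -> upto_sign (without B v) u.
Proof.
move=> Bu /eqP nuv /eqP nuNv.
case: Bu => Bu; [left|right]; split=> //.
  by move=> Nuv; apply: nuNv; rewrite -Nuv opprK.
by move/oppr_inj.
Qed.

Lemma minimal_markov_not_connected K d n (A : 'M[int]_(d, n)) M v :
  minimal_markov_basis K A M -> upto_sign M v ->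
  ~ connected (without M v) (vneg v) (vpos v).
Proof.
move=> [/markov_basisP[MA MI] Mmin] Mv cv; apply: (Mmin (without M v)).
- by move=> u [].
- by case: Mv => Mv; [exists v | exists (- v)] => // -[].
apply/markov_basisP; split=> [u [/MA]//|m m' m0 m'0 Amm'].
apply: (connected_of_moves m0) (MI _ _ m0 m'0 Amm') => u Mu.
have [->//|/eqP nuv] := eqVneq u v.
have [->|/eqP nuNv] := eqVneq u (- v).
  by rewrite vposN vnegN; apply: connected_sym.
have := @connected_vneg_vpos _ (without M v) u 0; rewrite !add0r; apply=> //.
by move=> l; rewrite mxE.
Qed.

Section PositiveWeights.
Variables (n : nat) (A : 'M[int]_(1, n)).
Hypothesis Apos : forall l, 0 < A 0 l.
Implicit Types (B M : 'cV[int]_n -> Prop) (m u v w y z : 'cV[int]_n).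

Lemma in_kerE z : in_ker A z <-> \sum_l A 0 l * z l 0 = 0.
Proof.
split=> [Az|Az]; first by have := congr1 (fun x : 'M_1 => x 0 0) Az; rewrite !mxE.
by apply/matrixP => r c; rewrite !ord1 !mxE.
Qed.

Lemma in_ker_nat_eq0 z : in_ker A z -> is_nat_vec z -> z = 0.
Proof.
move=> /in_kerE Az z0.
have Az0 l : true -> 0 <= A 0 l * z l 0 by rewrite mulr_ge0 ?z0 // ltW.
apply/colP => l /=; rewrite mxE; apply/eqP.
have /eqP : A 0 l * z l 0 = 0 by exact: (psumr_eq0P Az0 Az).
by rewrite mulf_eq0 gt_eqF.
Qed.

Definition weight v : int := (A *m v) 0 0.

Lemma weightB v w : weight (v - w) = weight v - weight w.
Proof. by rewrite /weight mulmxBr !mxE. Qed.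

Lemma weight_ge0 v : is_nat_vec v -> 0 <= weight v.
Proof.
move=> v0; rewrite /weight mxE sumr_ge0 // => l _.
by rewrite mulr_ge0 ?v0 // ltW.
Qed.

Lemma weight_delta l : weight (delta_mx l 0) = A 0 l.
Proof. by rewrite /weight -colE mxE. Qed.

(* A walk through points lighter than [vpos v] has no room for the step [v]. *)
Lemma connected_lighter B v m m' : (forall u, B u -> in_ker A u) ->
  is_nat_vec m -> weight m < weight (vpos v) ->
  connected B m m' -> connected (without B v) m m'.
Proof.
move=> BA + + c; elim: c => {m m'} [m|m u m' Bu mu0 _ IH] m0 lt_mv.
  exact: connected_refl.
have Au := upto_sign_ker BA Bu.
have weight_mu : weight (m + u) = weight m by rewrite /weight mulmxDr Au addr0.
have le_um : weight (vpos u) <= weight m.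
  rewrite /weight in_ker_vpos_vneg // -subr_ge0 -/(weight m) -/(weight _).
  by rewrite -weightB weight_ge0 //; apply: sub_vneg_nat.
apply: connected_step (IH mu0 _); rewrite ?weight_mu //.
apply: upto_sign_without => //; apply/eqP => def_u; move: le_um.
  by rewrite def_u leNgt lt_mv.
rewrite def_u /weight vposN -in_ker_vpos_vneg -/(weight _).
  by rewrite leNgt lt_mv.
by rewrite -[v]opprK -def_u; apply: in_kerN.
Qed.

Section MinimalMarkovBasis.
Variables (K : fieldType) (M : 'cV[int]_n -> Prop).
Hypothesis Mmin : minimal_markov_basis K A M.

Lemma minimal_markov_ker u : upto_sign M u -> in_ker A u.
Proof. by case: Mmin => -[MA _] _; apply: upto_sign_ker. Qed.

Lemma minimal_markov_connected m m' : is_nat_vec m -> is_nat_vec m' ->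
  A *m m = A *m m' -> connected M m m'.
Proof. by case: Mmin => /markov_basisP[_ MI] _; apply: MI. Qed.

(* Dividing by the common variable makes the two monomials lighter than [v]. *)
Lemma connected_without_common v m m' l :
  is_nat_vec m -> is_nat_vec m' ->
  A *m m = A *m vpos v -> A *m m' = A *m vpos v ->
  0 < m l 0 -> 0 < m' l 0 -> connected (without M v) m m'.
Proof.
move=> m0 m'0 Am Am' ml m'l; pose e : 'cV[int]_n := delta_mx l 0.
have e_entry l' : e l' 0 = (l' == l)%:R by rewrite mxE eqxx andbT.
have sub_e_nat x : is_nat_vec x -> 0 < x l 0 -> is_nat_vec (x - e).
  move=> x0 xl l'; rewrite !entryE e_entry.
  by have [->|_] := eqVneq l' l; [lia | rewrite subr0].
have [me0 m'e0] := (sub_e_nat _ m0 ml, sub_e_nat _ m'0 m'l).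
have e0 : is_nat_vec e by move=> l'; rewrite e_entry ler0n.
rewrite -(subrK e m) -(subrK e m'); apply: connected_translate => //.
apply: connected_lighter => //; first by case: Mmin => -[].
  by rewrite weightB /weight -Am -!/(weight _) weight_delta gtrBl.
by apply: minimal_markov_connected => //; rewrite !mulmxBr Am Am'.
Qed.

Lemma minimal_markov_disjoint v f g l : upto_sign M v ->
  connected (without M v) (vneg v) f -> connected (without M v) (vpos v) g ->
  0 < f l 0 -> g l 0 <= 0.
Proof.
move=> Mv cf cg fl; rewrite leNgt; apply/negP => gl.
have Av := minimal_markov_ker Mv.
have ker_without u : without M v u -> in_ker A u.
  by case=> Mu _ _; apply: minimal_markov_ker; left.
have [f0 g0] := (connected_nat (vneg_nat v) cf, connected_nat (vpos_nat v) cg).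
apply: (minimal_markov_not_connected Mmin Mv); apply: (connected_trans cf).
apply: connected_trans (connected_sym (vpos_nat v) cg).
apply: connected_without_common fl gl => //.
  by rewrite (connected_fiber ker_without cf) in_ker_vpos_vneg.
exact: connected_fiber ker_without cg.
Qed.

End MinimalMarkovBasis.
End PositiveWeights.

(** * Distance reduction by pure moves *)

Section DistanceReduction.
Variable n : nat.
Implicit Types (M : 'cV[int]_n -> Prop) (u z : 'cV[int]_n).

Definition reducible M z : Prop := exists2 u, M u & reduces_distance_of u z.

Definition shortens u z : Prop :=
  is_nat_vec (vpos z + u) /\ norm1 (z + u) < norm1 z.

Lemma shortens_neq0 u z : shortens u z -> u != 0.
Proof. by case=> _; apply: contraTneq => ->; rewrite addr0 ltxx. Qed.

Lemma reducibleP M z : reducible M z <->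
  exists2 u, upto_sign M u & shortens u z \/ shortens u (- z).
Proof.
have shortens_pos u :
    shortens u z <->
    is_nat_vec (vpos z + u) /\ norm1 (vpos z + u - vneg z) < norm1 z.
  by rewrite addrAC vpos_sub_vneg.
have shortens_neg u : shortens u (- z) <->
    is_nat_vec (vneg z + u) /\ norm1 (vneg z + u - vpos z) < norm1 z.
  by rewrite /shortens vposN norm1N addrAC -[vneg z - _]opprB vpos_sub_vneg.
split=> [[u Mu [pq [eps [pqz [eps1 pq_eps]]]]]|[w Mw zw]].
  exists (eps *: u).
    by case: eps1 => ->; [left|right]; rewrite ?scaleN1r ?opprK ?scale1r.
  case: pqz pq_eps => -> /= pq_eps.
    by left; apply/shortens_pos.
  by right; apply/shortens_neg.
have [u Mu [eps eps1 def_w]] : exists2 u, M u &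
    exists2 eps : int, eps = 1 \/ eps = -1 & w = eps *: u.
  case: Mw => Mw; [exists w | exists (- w)] => //.
    by exists 1; [left | rewrite scale1r].
  by exists (-1); [right | rewrite scaleN1r opprK].
rewrite def_w in zw; exists u => //.
case: zw => [/shortens_pos zw | /shortens_neg zw].
  by exists (vpos z, vneg z), eps; intuition.
by exists (vneg z, vpos z), eps; intuition.
Qed.

Lemma reducible_shortens M u z : upto_sign M u -> shortens u z -> reducible M z.
Proof. by move=> Mu uz; apply/reducibleP; exists u => //; left. Qed.

Lemma reducibleN M z : reducible M (- z) -> reducible M z.
Proof.
move=> /reducibleP[u Mu uz]; apply/reducibleP; exists u => //.
by move: uz; rewrite opprK or_comm.
Qed.

End DistanceReduction.

Section PureMoves.
Variables (n : nat) (A : 'M[int]_(1, n)).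
Hypothesis Apos : forall l, 0 < A 0 l.
Implicit Types (M : 'cV[int]_n -> Prop) (u w y z : 'cV[int]_n).

(* The monomial [x^(vneg z)] is a pure power of [x_l]. *)
Definition pure_at l z : Prop :=
  [/\ in_ker A z, z l 0 < 0 & forall l', l' != l -> 0 <= z l' 0].

(* [- w l 0] is the least c > 0 such that c a_l is a sum of other weights. *)
Definition critical l w : Prop :=
  pure_at l w /\ forall y, pure_at l y -> y l 0 <= w l 0.

Lemma in_ker_pure_at l z : in_ker A z -> z != 0 ->
  (forall l', l' != l -> 0 <= z l' 0) -> pure_at l z.
Proof.
move=> Az nz0 z_ge0; split=> //; rewrite ltNge; apply: contraNN nz0 => zl.
by apply/eqP/(in_ker_nat_eq0 Apos) => // l'; have [->|/z_ge0] := eqVneq l' l.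
Qed.

Lemma in_ker_le0 l z : in_ker A z ->
  (forall l', l' != l -> 0 <= z l' 0) -> z l 0 <= 0.
Proof.
have [->|nz0] := eqVneq z 0; first by rewrite mxE.
by move=> Az /(in_ker_pure_at Az nz0)[_ /ltW].
Qed.

Lemma pure_at_add_nat l u z :
  pure_at l u -> - u l 0 <= z l 0 -> is_nat_vec (vpos z + u).
Proof.
move=> [_ ul u_ge0] le_uz l'; rewrite !entryE.
by have [->|/u_ge0] := eqVneq l' l; lia.
Qed.

Lemma pure_at_min_weight_lt l u :
  (forall l', l' != l -> A 0 l < A 0 l') -> pure_at l u ->
  \sum_(l' | l' != l) u l' 0 < - u l 0.
Proof.
move=> lt_l [/in_kerE Au ul u_ge0]; rewrite (bigD1 l) //= in Au.
set S := \sum_(l' | _) _.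
have : (A 0 l + 1) * S <= \sum_(l' | l' != l) A 0 l' * u l' 0.
  rewrite mulr_sumr; apply: ler_sum => l' nl'.
  by rewrite ler_wpM2r ?u_ge0 // -ltzD1 ltrD2r lt_l.
have lt_of_weighted (a x s t : int) :
    0 < a -> x < 0 -> a * x + t = 0 -> (a + 1) * s <= t -> s < - x.
  by nia.
exact: lt_of_weighted (Apos l) ul Au.
Qed.

Section MinimalMarkovBasis.
Variables (K : fieldType) (M : 'cV[int]_n -> Prop).
Hypothesis Mmin : minimal_markov_basis K A M.

Lemma markov_pure_at l y : pure_at l y ->
  exists2 u, upto_sign M u & pure_at l u /\ y l 0 <= u l 0.
Proof.
move=> [Ay yl y_ge0]; have Apn := in_ker_vpos_vneg Ay.
have nypn : vneg y != vpos y.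
  by apply/eqP => /(congr1 (fun x : 'cV__ => x l 0)); rewrite !entryE; lia.
have cy := minimal_markov_connected Mmin (vneg_nat y) (vpos_nat y) (esym Apn).
have [u Mu [nu0 yu0]] := connected_neq_move cy nypn.
exists u => //; split; last by have := yu0 l; rewrite !entryE; lia.
apply: in_ker_pure_at => // [|l' nl']; first exact: (minimal_markov_ker Mmin).
by have := y_ge0 _ nl'; have := yu0 l'; rewrite !entryE; lia.
Qed.

Lemma noncritical_connected v l : upto_sign M v -> pure_at l v ->
  ~ critical l v ->
  exists2 u, pure_at l u /\ v l 0 < u l 0 &
    connected (without M v) (vneg v) (vneg v + u).
Proof.
move=> Mv pv ncrit; have [Av vl v_ge0] := pv.
have [y py lt_vy] : exists2 y, pure_at l y & v l 0 < y l 0.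
  apply: contrapT => no_y; apply: ncrit; split=> // y py.
  by rewrite leNgt; apply/negP => lt_vy; apply: no_y; exists y.
have [u Mu [pu le_yu]] := markov_pure_at py.
have lt_vu := lt_le_trans lt_vy le_yu; exists u => //.
apply: connected_move; last first.
  by rewrite -vposN; apply: pure_at_add_nat pu _; rewrite entryE lerN2 ltW.
have [_ ul _] := pu; apply: upto_sign_without => //; apply/eqP => def_u.
  by rewrite def_u ltxx in lt_vu.
by move: ul; rewrite def_u entryE; lia.
Qed.

Lemma reducible_of_min_weight l y z :
  (forall l', l' != l -> A 0 l < A 0 l') -> pure_at l y -> - y l 0 <= z l 0 ->
  reducible M z.
Proof.
move=> lt_l py le_yz; have [u Mu [pu le_yu]] := markov_pure_at py.
have le_uz : - u l 0 <= z l 0 by apply: le_trans le_yz; rewrite lerN2.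
apply: reducible_shortens Mu _; split; first exact: pure_at_add_nat le_uz.
have lt_u := pure_at_min_weight_lt lt_l pu; have [_ ul u_ge0] := pu.
rewrite /norm1 (bigD1 l) // [ltRHS](bigD1 l) //= add_colE.
have le_sum : \sum_(l' | l' != l) `|(z + u) l' 0| <=
    \sum_(l' | l' != l) `|z l' 0| + \sum_(l' | l' != l) u l' 0.
  rewrite -big_split /=; apply: ler_sum => l' /u_ge0; rewrite add_colE; lia.
apply: le_lt_trans (lerD (lexx _) le_sum) _.
rewrite addrCA [ltRHS]addrC ltrD2l -ltrBrDl; apply: lt_le_trans lt_u _.
lia.
Qed.

End MinimalMarkovBasis.
End PureMoves.

(** * Three weights *)

Section PairCircuit.
Variables (n : nat) (A : 'M[int]_(1, n)).

Definition pair_circuit j k : 'cV[int]_n :=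
  A 0 k *: delta_mx j 0 - A 0 j *: delta_mx k 0.

Lemma pair_circuitE j k l :
  pair_circuit j k l 0 = A 0 k *+ (l == j) - A 0 j *+ (l == k).
Proof. by rewrite !mxE eqxx !andbT !mulr_natr. Qed.

Lemma pair_circuitN j k : - pair_circuit j k = pair_circuit k j.
Proof. exact: opprB. Qed.

Lemma pair_circuit_in_ker j k : in_ker A (pair_circuit j k).
Proof.
rewrite /in_ker mulmxBr -!scalemxAr -!colE.
by apply/matrixP => r c; rewrite !ord1 !mxE mulrC subrr.
Qed.

Lemma pair_circuitP j k :
  (forall l, A 0 l != 0) -> j != k -> circuit A (pair_circuit j k).
Proof.
move=> nA0 njk; have supp : [set l | pair_circuit j k l 0 != 0] = [set j; k].
  apply/setP => l; rewrite !inE pair_circuitE.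
  have [->|_] := eqVneq l j; first by rewrite (negPf njk) subr0 nA0.
  by rewrite sub0r oppr_eq0; have [_|_] := eqVneq l k; rewrite ?nA0 ?eqxx.
split; first exact: pair_circuit_in_ker.
split; last by rewrite supp cards2 njk.
apply/eqP => z0; have : j \in [set j; k] by rewrite !inE eqxx.
by rewrite -supp inE z0 mxE eqxx.
Qed.

End PairCircuit.

Lemma mem_uniq_ord n (s : seq 'I_n) :
  uniq s -> size s = n -> s =i 'I_n.
Proof.
move=> Us size_s; apply/subset_cardP; last by apply/subsetP.
by rewrite (card_uniqP Us) card_ord.
Qed.

Lemma uniq3_neq (T : eqType) (x y z : T) :
  uniq [:: x; y; z] -> [/\ x != y, x != z & y != z].
Proof. by rewrite /= !inE negb_or andbT => /andP[/andP[-> ->] ->]. Qed.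

Lemma uniq3_swap12 (T : eqType) (x y z : T) :
  uniq [:: x; y; z] -> uniq [:: y; x; z].
Proof. by rewrite (uniq_catCA [:: y] [:: x] [:: z]). Qed.

Lemma uniq3_swap23 (T : eqType) (x y z : T) :
  uniq [:: x; y; z] -> uniq [:: x; z; y].
Proof. by rewrite (uniq_catC [:: x; z] [:: y]) => /uniq3_swap12. Qed.

Section DistinctTriples.
Variables i j k : 'I_3.
Hypothesis ijk : uniq [:: i; j; k].
Implicit Types (A : 'M[int]_(1, 3)) (z : 'cV[int]_3).

Lemma ord3_ind (P : 'I_3 -> Prop) : P i -> P j -> P k -> forall l, P l.
Proof.
move=> Pi Pj Pk l; have : l \in [:: i; j; k] by rewrite mem_uniq_ord.
by rewrite !inE => /or3P[] /eqP->.
Qed.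

Lemma sum_ord3 (F : 'I_3 -> int) : \sum_l F l = F i + F j + F k.
Proof.
rewrite -(eq_bigl _ _ (mem_uniq_ord ijk (erefl _))) -big_uniq //.
by rewrite !big_cons big_nil /= addr0 addrA.
Qed.

Lemma norm1_3 z : norm1 z = `|z i 0| + `|z j 0| + `|z k 0|.
Proof. exact: sum_ord3. Qed.

Lemma in_ker3 A z :
  in_ker A z -> A 0 i * z i 0 + A 0 j * z j 0 + A 0 k * z k 0 = 0.
Proof. by move/in_kerE; rewrite sum_ord3. Qed.

Lemma pure_at3 A z : pure_at A i z <->
  [/\ in_ker A z, z i 0 < 0, 0 <= z j 0 & 0 <= z k 0].
Proof.
have [nij nik _] := uniq3_neq ijk; split=> [[Az zi z_ge0]|[Az zi zj zk]].
  by split=> //; apply: z_ge0; rewrite eq_sym.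
by split=> //; apply: ord3_ind; rewrite ?eqxx.
Qed.

Lemma in_ker3_pure_at A z : (forall l, 0 < A 0 l) -> in_ker A z ->
  z != 0 -> 0 <= z j 0 -> 0 <= z k 0 -> pure_at A i z.
Proof.
move=> Apos Az nz0 zj zk; apply: (in_ker_pure_at Apos Az nz0).
by apply: ord3_ind; rewrite ?eqxx.
Qed.

Lemma in_ker3_le0 A z : (forall l, 0 < A 0 l) -> in_ker A z ->
  0 <= z j 0 -> 0 <= z k 0 -> z i 0 <= 0.
Proof.
move=> Apos Az zj zk; apply: (in_ker_le0 Apos Az).
by apply: ord3_ind; rewrite ?eqxx.
Qed.

End DistinctTriples.

Lemma exists_strict_min d (T : orderType d) n (f : 'I_n.+1 -> T) :
  injective f -> exists i, forall l, l != i -> (f i < f l)%O.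
Proof.
move=> inj_f; exists [arg min_(l < ord0) f l]%O => l.
case: arg_minP => // i _ min_i nli.
by rewrite lt_neqAle min_i // (inj_eq inj_f) eq_sym nli.
Qed.

Lemma uniq3_extend (i : 'I_3) : exists j k, uniq [:: i; j; k].
Proof. by exists (i + 1), (i + 1 + 1); case: i => -[|[|[|//]]] ?. Qed.

Lemma in_ker3_pure (A : 'M[int]_(1, 3)) (z : 'cV[int]_3) :
  (forall l, 0 < A 0 l) -> in_ker A z -> z != 0 ->
  exists l, pure_at A l z \/ pure_at A l (- z).
Proof.
move=> Apos Az nz0; have [j [k ijk]] := uniq3_extend 0; set i := 0 in ijk.
have [jik ikj] := (uniq3_swap12 ijk, uniq3_swap23 ijk).
have kij := uniq3_swap12 ikj.
have pure l m p : uniq [:: l; m; p] -> 0 <= z m 0 -> 0 <= z p 0 ->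
    exists l, pure_at A l z \/ pure_at A l (- z).
  by move=> lmp zm zp; exists l; left; apply: (in_ker3_pure_at lmp).
have pureN l m p : uniq [:: l; m; p] -> z m 0 < 0 -> z p 0 < 0 ->
    exists l, pure_at A l z \/ pure_at A l (- z).
  move=> lmp zm zp; exists l; right; apply: (in_ker3_pure_at lmp) => //.
  - exact: in_kerN.
  - by rewrite oppr_eq0.
  - by rewrite opp_colE oppr_ge0 ltW.
  - by rewrite opp_colE oppr_ge0 ltW.
have [zj|zj] := leP 0 (z j 0); have [zk|zk] := leP 0 (z k 0).
- exact: (pure i j k).
- by have [?|?] := leP 0 (z i 0); [apply: (pure k i j) | apply: (pureN j i k)].
- by have [?|?] := leP 0 (z i 0); [apply: (pure j i k) | apply: (pureN k i j)].
- exact: (pureN i j k).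
Qed.

Section ThreeWeights.
Variables (K : fieldType) (A : 'M[int]_(1, 3)).
Hypothesis Apos : forall l, 0 < A 0 l.
Variable M : 'cV[int]_3 -> Prop.
Hypothesis Mmin : minimal_markov_basis K A M.
Implicit Types (i j k l : 'I_3) (u w x y z : 'cV[int]_3).

(* Up to exchanging [j] and [k], these are the moves of [M] that shorten the
   circuit on [{j, k}]. *)
Definition circuit_move i j k w : Prop :=
  [/\ upto_sign M w, pure_at A j w & w i 0 < w k 0 - w j 0].

Lemma shortens_pair_circuit i j k w : uniq [:: i; j; k] -> upto_sign M w ->
  shortens w (pair_circuit A j k) -> circuit_move i j k w.
Proof.
move=> ijk Mw; have jik := uniq3_swap12 ijk.
have [nij nik njk] := uniq3_neq ijk.
have [zi zj zk] : [/\ pair_circuit A j k i 0 = 0,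
    pair_circuit A j k j 0 = A 0 k & pair_circuit A j k k 0 = - A 0 j].
  rewrite !pair_circuitE !eqxx (eq_sym k j).
  by rewrite (negPf nij) (negPf nik) (negPf njk) subr0 sub0r subr0.
move: (pair_circuit A j k) zi zj zk => z zi zj zk shwz.
have nw0 := shortens_neq0 shwz; have [w_nat] := shwz.
move: (w_nat i) (w_nat j) (w_nat k); rewrite !(norm1_3 ijk) !entryE zi zj zk.
have [Aj Ak] := (Apos j, Apos k) => wi wj wk lt_w.
have Aw := minimal_markov_ker Mmin Mw.
by split=> //; [apply: (in_ker3_pure_at jik) => //; lia | lia].
Qed.

Lemma exists_circuit_move i j k : uniq [:: i; j; k] ->
  reduces_distance_set M (circuit A) ->
  exists w, circuit_move i j k w \/ circuit_move i k j w.
Proof.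
move=> ijk redM; have [_ _ njk] := uniq3_neq ijk.
have circ := pair_circuitP (fun l => lt0r_neq0 (Apos l)) njk.
have /reducibleP[w Mw []] := redM _ circ (proj1 (proj2 circ)).
  by move/(shortens_pair_circuit ijk Mw) => cw; exists w; left.
rewrite pair_circuitN => /(shortens_pair_circuit (uniq3_swap23 ijk) Mw) cw.
by exists w; right.
Qed.

(* If [w] is critical neither at [j] nor, negated, at [k], its two monomials can
   each be moved to a monomial divisible by [x_i] without using [w], against
   disjointness. *)
Lemma circuit_move_critical i j k w : uniq [:: i; j; k] -> A 0 i < A 0 j ->
  circuit_move i j k w ->
  critical A j w \/ critical A k (- w) /\ circuit_move i k j (- w).
Proof.
move=> ijk lt_ij [Mw pw lt_w].
have [jik kij] := (uniq3_swap12 ijk, uniq3_swap12 (uniq3_swap23 ijk)).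
have [Aw wj wi wk] := proj1 (pure_at3 jik A w) pw.
have [[Ai Aj] Ak] := (Apos i, Apos j, Apos k).
have [|ncrit] := pselect (critical A j w); [by left | right].
have [u [pu lt_wu] cu] := noncritical_connected Apos Mmin Mw pw ncrit.
have [Au uj ui uk] := proj1 (pure_at3 jik A u) pu.
have disj l := minimal_markov_disjoint Apos Mmin (l := l) Mw cu
  (connected_refl _ _).
have wk_gt0 : 0 < w k 0 by have := in_ker3 ijk Aw; nia.
have uk0 : u k 0 = 0 by have := disj k; rewrite !entryE; lia.
have ui_gt0 : 0 < u i 0.
  by have := in_ker3 ijk Au; rewrite uk0; nia.
have wi0 : w i 0 = 0 by have := disj i; rewrite !entryE; lia.
have pNw : pure_at A k (- w).
  by apply/(pure_at3 kij); rewrite !opp_colE; split; [exact: in_kerN | lia..].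
split; last by split; [exact: upto_signN | | rewrite !opp_colE; lia].
apply: contrapT => /(noncritical_connected Apos Mmin (upto_signN Mw) pNw).
rewrite withoutN vnegN => -[u' [pu' lt_wu'] cu'].
have [Au' u'k u'i u'j] := proj1 (pure_at3 kij A u') pu'.
have u'j0 : u' j 0 = 0.
  have := minimal_markov_disjoint Apos Mmin (l := j) Mw (connected_refl _ _) cu'.
  by rewrite !entryE; lia.
have u'i_gt0 : 0 < u' i 0.
  by have := in_ker3 ijk Au'; rewrite u'j0; nia.
have := minimal_markov_disjoint Apos Mmin (l := i) Mw cu cu'.
by rewrite !entryE; lia.
Qed.

Lemma reducible_overshoot i l m x u : uniq [:: i; l; m] ->
  (forall l', l' != i -> A 0 i < A 0 l') -> in_ker A x -> pure_at A l u ->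
  x l 0 <= u l 0 -> x m 0 < u m 0 -> reducible M x.
Proof.
move=> ilm min_i Ax pu le_xul lt_xum.
have [Au _ ui _] := proj1 (pure_at3 (uniq3_swap12 ilm) A u) pu.
apply: (reducible_of_min_weight Apos Mmin (y := u - x) min_i).
  apply: (in_ker3_pure_at ilm) => //; rewrite ?entryE; try lia.
    exact: in_kerB.
  by apply: (@col_neq0 _ _ m); rewrite !entryE; lia.
by rewrite !entryE; lia.
Qed.

Section CriticalCircuitMove.
Variables (i j k : 'I_3) (w : 'cV[int]_3).
Hypothesis ijk : uniq [:: i; j; k].
Hypothesis min_i : forall l, l != i -> A 0 i < A 0 l.
Hypothesis w_move : circuit_move i j k w.
Hypothesis w_critical : critical A j w.

Let jik : uniq [:: j; i; k] := uniq3_swap12 ijk.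
Let ikj : uniq [:: i; k; j] := uniq3_swap23 ijk.
Let kij : uniq [:: k; i; j] := uniq3_swap12 ikj.

Lemma reducible_pure_at_critical x : pure_at A j x -> reducible M x.
Proof.
move=> px; have [Mw pw lt_w] := w_move; have [_ /(_ _ px) le_xwj] := w_critical.
have [Ax xj xi xk] := proj1 (pure_at3 jik A x) px.
have [lt_xwk|le_wxk] := ltP (x k 0) (w k 0).
  exact: (reducible_overshoot ijk min_i Ax pw).
have [_ wj wi wk] := proj1 (pure_at3 jik A w) pw.
apply: reducibleN; apply: reducible_shortens Mw _; split.
  by apply: pure_at_add_nat pw _; rewrite opp_colE lerN2.
by rewrite !(norm1_3 ijk) !entryE; lia.
Qed.

Lemma reducible_pure_at_noncritical x : pure_at A k x -> reducible M x.
Proof.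
move=> px; have [u Mu [pu le_xuk]] := markov_pure_at Apos Mmin px.
have [Ax xk xi xj] := proj1 (pure_at3 kij A x) px.
have [Au uk ui uj] := proj1 (pure_at3 kij A u) pu.
have [lt_xuj|le_uxj] := ltP (x j 0) (u j 0).
  exact: (reducible_overshoot ikj min_i Ax pu).
have [le_uxi|lt_xui] := leP (u i 0) (x i 0).
  apply: reducibleN; apply: reducible_shortens Mu _; split.
    by apply: pure_at_add_nat pu _; rewrite opp_colE lerN2.
  by rewrite !(norm1_3 ijk) !entryE; lia.
have [Mw pw lt_w] := w_move; have [Aw wj wi wk] := proj1 (pure_at3 jik A w) pw.
(* [u - x] is pure at [j], so [x j 0] is large enough for [w] to be added. *)
have le_uxw : (u - x) j 0 <= w j 0.
  apply: (proj2 w_critical); apply: (in_ker3_pure_at jik) => //.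
  - exact: in_kerB.
  - by apply: (@col_neq0 _ _ i); rewrite !entryE; lia.
  - by rewrite !entryE; lia.
  - by rewrite !entryE; lia.
rewrite !entryE in le_uxw.
have le_xwk : (x + w) k 0 <= 0.
  apply: (in_ker3_le0 kij Apos (in_kerD Ax Aw)); rewrite !entryE; lia.
rewrite entryE in le_xwk.
apply: reducible_shortens Mw _; split; last first.
  by rewrite !(norm1_3 ijk) !entryE; lia.
by apply: pure_at_add_nat pw _; lia.
Qed.

Lemma reducible_of_critical z : in_ker A z -> z != 0 -> reducible M z.
Proof.
move=> Az nz0.
have reducible_pure l x : pure_at A l x -> reducible M x.
  move: l; apply: (ord3_ind ijk) => px.
  - apply: reducibleN; apply: (reducible_of_min_weight Apos Mmin min_i px).
    by rewrite opp_colE lexx.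
  - exact: reducible_pure_at_critical.
  - exact: reducible_pure_at_noncritical.
have [l [pz|pNz]] : exists l, pure_at A l z \/ pure_at A l (- z).
  exact: in_ker3_pure.
- exact: reducible_pure pz.
- exact/reducibleN/(reducible_pure l).
Qed.

End CriticalCircuitMove.

Lemma reducible_of_circuit_move i j k w z : uniq [:: i; j; k] ->
  (forall l, l != i -> A 0 i < A 0 l) -> circuit_move i j k w ->
  in_ker A z -> z != 0 -> reducible M z.
Proof.
move=> ijk min_i cw; have ikj := uniq3_swap23 ijk.
have lt_ij : A 0 i < A 0 j.
  by apply: min_i; rewrite eq_sym; case: (uniq3_neq ijk).
have [crit|[crit cNw]] := circuit_move_critical ijk lt_ij cw.
  exact: (reducible_of_critical ijk min_i cw crit).
exact: (reducible_of_critical ikj min_i cNw crit).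
Qed.

End ThreeWeights.

Theorem theorem3p1 (K : fieldType) (A : 'M[int]_(1, 3))
    (Hpos : forall j, 0 < A 0 j)
    (Hdist : forall j k, j != k -> A 0 j != A 0 k)
    (M : 'cV[int]_3 -> Prop)
    (HM : minimal_markov_basis K A M) :
  distance_reducing A M <-> reduces_distance_set M (circuit A).
Proof.
split=> [redM z [Az _]|redC z Az nz0]; first exact: redM.
have [i min_i] := exists_strict_min (fun j k => contra_eq (Hdist j k)).
have [j [k ijk]] := uniq3_extend i.
have [w [cw|cw]] := exists_circuit_move Hpos HM ijk redC.
  exact: (reducible_of_circuit_move Hpos HM ijk min_i cw).
exact: (reducible_of_circuit_move Hpos HM (uniq3_swap23 ijk) min_i cw).
Qed.
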